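(* Let $K=\mathbf{C}$, let $V$ be an $n$-dimensional $K$-vector space, let $b_1,\dots,b_p\ge 1$ be integers with $b_1+\dots+b_p=n$, and put $d_0=0$ and $d_k=b_1+\dots+b_k$ for $1\le k\le p$ (so $d_p=n$). Let $F_*=(0=F_0\subset F_1\subset\dots\subset F_{p-1}\subset F_p=V)$ be a partial flag with $\dim_K F_k=d_k$ for all $k$, and let $\varphi$ be a nilpotent endomorphism of $V$. Then the following are equivalent: 1. $\dim_K \varphi^{\,n-d_k}(F_k)=d_k$ for every $k\in\{0,\dots,p\}$. 2. There exists a basis $\{w_1,\dots,w_n\}$ of $V$ such that (a) for all $k\in\{1,\dots,p\}$: $F_k=\langle w_1,\dots,w_{d_k}\rangle$; and (b) for every $k\in\{2,\dots,p\}$: $$\varphi(w_x)=\begin{cases} w_{x+1} \bmod \langle w_{d_1+2},\dots,w_n\rangle, & \text{if } x<d_1;\\ w_{x+1} \bmod \langle w_{d_k+1},\dots,w_n\rangle, & \text{if } d_{k-1}\le x<d_k;\\ 0, & \text{if } x=n.\end{cases}$$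
   Context: $\langle\cdots\rangle$ denotes the $K$-linear span (the zero space if the list is empty). The notation $\varphi(w_x)=w_{x+1}\bmod W$ means $\varphi(w_x)-w_{x+1}\in W$. $\varphi^0$ is the identity. *)

(* Defs.v *)
From mathcomp Require Import all_boot all_order all_algebra.
From mathcomp Require Import reals complex.

Set Implicit Arguments.
Unset Strict Implicit.
Unset Printing Implicit Defensive.

Import GRing.Theory.
Local Open Scope ring_scope.

Section Endomorphisms.
Variables (K : fieldType) (V : vectType K).

(* 'End(V) carries no canonical ring structure for an abstract vectType (V may
   be zero), so powers for composition are written out. *)
Definition lfun_pow (phi : 'End(V)) (m : nat) : 'End(V) :=
  iter m (comp_lfun phi) \1%VF.

Definition nilpotent_lfun (phi : 'End(V)) : Prop :=
  exists m : nat, lfun_pow phi m = 0.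

(* Families w_1, w_2, ... are functions on nat, 1-indexed; their values outside
   the range under consideration are irrelevant. *)
Definition vfamily (w : nat -> V) (i j : nat) : seq V :=
  [seq w x | x <- index_iota i j.+1].

(* <w_i, ..., w_j>, which is the zero space if j < i. *)
Definition span_fam (w : nat -> V) (i j : nat) : {vspace V} :=
  <<vfamily w i j>>%VS.

Definition is_flag_of_dims (p : nat) (d : nat -> nat) (F : nat -> {vspace V})
    : Prop :=
  [/\ F 0%N = 0%VS, F p = fullv,
      forall k, (k < p)%N -> (F k <= F k.+1)%VS
    & forall k, (k <= p)%N -> \dim (F k) = d k].

End Endomorphisms.

(* d_k = b_1 + ... + b_k; in particular d_0 = 0. *)
Definition partial_sum (b : nat -> nat) (k : nat) : nat :=
  (\sum_(1 <= i < k.+1) b i)%N.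

(* Main.v *)
Require Import Defs.
From mathcomp Require Import all_boot all_order all_algebra.
From mathcomp Require Import reals complex.
From mathcomp Require Import zify.

Set Implicit Arguments.
Unset Strict Implicit.
Unset Printing Implicit Defensive.

Import GRing.Theory.
Local Open Scope ring_scope.

(** Write [I_j] for the image of [phi^j].  Everything rests on the descending
    filtration [V = I_0 >= I_1 >= ...].

    When [p = 1] both sides hold: the first says that the identity preserves
    the dimension of [V], and the second only asks for a basis.  Let [p > 1].

    Either side forces [phi] to be a single nilpotent Jordan block, that is
    [dim I_j = n - j] for [j <= n].  From the dimension condition at [k = 1]
    this holds because the rank of [phi^(n - d_1)] is at least [d_1], the most
    a nilpotent endomorphism can have there, which leaves no room for a second
    block ([regular_nilpotent_of_rank]).  From a basis [w], the congruences give
    [phi (w x) = w (x+1)] up to later vectors, hence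
    [I_j = <w_(j+1), ..., w_n>] ([im_pow_of_shift]).

    For a single block the kernel of [phi^(n - d)] is [I_d], so the dimension
    condition at [k] says exactly that [F_k] meets [I_(d_k)] trivially, or
    equivalently that [V] is the direct sum of the two
    ([dim_limg_complement], [addv_complement]).  Given a basis [w], this is the
    independence of [w_1, ..., w_(d_k)] and [w_(d_k+1), ..., w_n].

    Conversely, suppose that all these sums are direct, and let [pi_k] be the
    projection onto [F_k] along [I_(d_k)].  Put [w_1 = pi_1 u] for a vector [u]
    outside [I_1], and [w_(x+1) = pi_k (phi (w_x))], where [k] is the block
    containing [x+1].  Then [w_x] generates [I_(x-1)] modulo [I_x], so [w] is a
    basis with [<w_(j+1), ..., w_n> = I_j]; it is adapted to the flag, and the
    error [phi (w_x) - w_(x+1)] lies in [I_(d_k)].  In the first block the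
    error is required to lie in the smaller space [I_(d_1+1)], and this is where
    the choice of [u] matters: it suffices that the first [d_1] vectors of the
    orbit of [u] lie in the hyperplane [F_1 + I_(d_1+1)], and such a [u] exists
    by [exists_cyclic_vector_in_hyperplane]. *)

(** * The filtration by images of powers *)

Section ImageFiltration.
Variables (K : fieldType) (V : vectType K) (phi : 'End(V)).
Local Notation n := (\dim (fullv : {vspace V})).

Lemma lfun_powD i j v :
  lfun_pow phi (i + j) v = lfun_pow phi i (lfun_pow phi j v).
Proof.
elim: i => [|i IHi]; first by rewrite id_lfunE.
by rewrite addSn /= !comp_lfunE -/(lfun_pow phi (i + j)) IHi.
Qed.

Definition im_pow j : {vspace V} := (lfun_pow phi j @: fullv)%VS.

Lemma im_pow0 : im_pow 0 = fullv.
Proof. by rewrite /im_pow /= lim1g. Qed.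

Lemma limg_im_pow i j : (lfun_pow phi i @: im_pow j)%VS = im_pow (i + j).
Proof.
rewrite /im_pow -limg_comp; congr (_ @: _)%VS.
by apply/lfunP=> v; rewrite comp_lfunE lfun_powD.
Qed.

Lemma im_powS j : (phi @: im_pow j)%VS = im_pow j.+1.
Proof. by rewrite -(limg_im_pow 1) /= comp_lfun1r. Qed.

Lemma im_pow_decr i j : (i <= j)%N -> (im_pow j <= im_pow i)%VS.
Proof.
move=> le_ij; rewrite -(subnKC le_ij) -limg_im_pow.
exact: limgS (subvf _).
Qed.

(** If the images of two consecutive powers coincide then the sequence of
    images is constant from there on, so by nilpotency it has already
    reached zero. *)
Lemma dim_im_pow_lt j :
  nilpotent_lfun phi -> (0 < \dim (im_pow j))%N ->
  (\dim (im_pow j.+1) < \dim (im_pow j))%N.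
Proof.
case=> m phim0; rewrite lt0n dimv_eq0 => nz_j.
have le_dim := dimv_leqif_eq (im_pow_decr (leqnSn j)).
rewrite (ltn_leqif le_dim); apply: contra nz_j => /eqP eq_j.
suffices const i : im_pow (i + j) = im_pow j.
  by rewrite -(const m) -limg_im_pow phim0 lim0g.
by elim: i => // i IHi; rewrite addSn -im_powS IHi im_powS.
Qed.

(** Equivalent to [phi] being a single nilpotent Jordan block. *)
Definition regular_nilpotent :=
  forall j, (j <= n)%N -> \dim (im_pow j) = (n - j)%N.

(** A nilpotent endomorphism loses at least one dimension at each step, so
    a single value [m] with [dim (im phi^m) >= n - m > 0] forces every step up
    to [m] to lose exactly one.  As [m > 0], the first step then says that the
    kernel is a line, and hence no later step can lose more than one. *)
Lemma regular_nilpotent_of_rank m :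
  nilpotent_lfun phi -> (0 < m < n)%N -> (n - m <= \dim (im_pow m))%N ->
  regular_nilpotent.
Proof.
move=> nil_phi /andP[m_gt0 lt_mn] rk_m.
have dim_le j : (j <= n)%N -> (\dim (im_pow j) <= n - j)%N.
  elim: j => [|j IHj] lt_jn; first by rewrite im_pow0 subn0.
  have := IHj (ltnW lt_jn); have := @dim_im_pow_lt j nil_phi.
  have := dimvS (im_pow_decr (leqnSn j)); lia.
(* Going down from [m] to [1], each step gains at least one dimension. *)
have ge1 : (n.-1 <= \dim (im_pow 1))%N.
  have step i : (i < m)%N -> (n - m + i <= \dim (im_pow (m - i)))%N.
    elim: i => [|i IHi] lt_im; first by rewrite addn0 subn0.
    have IH := IHi (ltnW lt_im); have := @dim_im_pow_lt (m - i.+1) nil_phi.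
    have := dimvS (im_pow_decr (leqnSn (m - i.+1))).
    have -> : (m - i.+1).+1 = (m - i)%N by lia.
    lia.
  have := step m.-1; have -> : (m - m.-1)%N = 1%N by lia.
  lia.
have ker1 : (\dim (lker phi) <= 1)%N.
  have := limg_ker_dim phi fullv; rewrite capfv -[in limg _]im_pow0 im_powS; lia.
elim=> [|j IHj] lt_jn; first by rewrite im_pow0 subn0.
have := limg_ker_dim phi (im_pow j); rewrite im_powS (IHj (ltnW lt_jn)).
have := dimvS (capvSr (im_pow j) (lker phi)); have := dim_le _ lt_jn; lia.
Qed.

Lemma regular_im_pow_dim : regular_nilpotent -> im_pow n = 0%VS.
Proof. by move=> reg; apply/eqP; rewrite -dimv_eq0 reg // subnn. Qed.

(** One inclusion is [phi^n = 0], and the dimensions agree. *)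
Lemma regular_lker j :
  regular_nilpotent -> (j <= n)%N -> lker (lfun_pow phi (n - j)) = im_pow j.
Proof.
move=> reg le_jn; apply/esym/eqP; rewrite eqEdim; apply/andP; split.
  by rewrite lkerE limg_im_pow subnK // regular_im_pow_dim.
have := limg_ker_dim (lfun_pow phi (n - j)) fullv.
rewrite capfv -/(im_pow _) !reg ?leq_subr //; lia.
Qed.

(** Both memberships say that [phi^(n - j)] kills [v]. *)
Lemma regular_mem_im_pow i j v :
  regular_nilpotent -> (i + j <= n)%N ->
  (lfun_pow phi i v \in im_pow (i + j)) = (v \in im_pow j).
Proof.
move=> reg le_ij; rewrite -!regular_lker //; last by lia.
by rewrite !memv_ker -lfun_powD; congr (lfun_pow phi _ v == 0); lia.
Qed.

Lemma regular_mem_im_powS j v :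
  regular_nilpotent -> (j < n)%N ->
  (phi v \in im_pow j.+1) = (v \in im_pow j).
Proof.
move=> reg lt_jn; rewrite -(@regular_mem_im_pow 1 j) //.
by rewrite [lfun_pow phi 1]comp_lfun1r.
Qed.

(** The kernel of [phi^(n - d)] is the image of [phi^d], so injectivity of
    [phi^(n - d)] on [U] says that [U] avoids that image. *)
Lemma dim_limg_complement d (U : {vspace V}) :
  regular_nilpotent -> (d <= n)%N -> \dim U = d ->
  \dim (lfun_pow phi (n - d) @: U) = d <-> (U :&: im_pow d = 0)%VS.
Proof.
move=> reg le_dn dimU; rewrite -regular_lker //.
have := limg_ker_dim (lfun_pow phi (n - d)) U; rewrite dimU => dimE.
split=> [eq_d | cap0]; first by apply/eqP; rewrite -dimv_eq0; lia.
by move: dimE; rewrite cap0 dimv0.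
Qed.

Lemma addv_complement d (U : {vspace V}) :
  regular_nilpotent -> (d <= n)%N -> \dim U = d ->
  (U :&: im_pow d = 0)%VS -> (U + im_pow d = fullv)%VS.
Proof.
move=> reg le_dn dimU cap0; apply/eqP; rewrite eqEdim subvf /=.
by rewrite dimv_disjoint_sum // dimU reg // subnKC.
Qed.

(** [f] maps [U :&: f @^-1: H] onto [f @: U :&: H], and its restrictions to
    [U] and to this subspace have the same kernel. *)
Lemma dim_cap_lpreim (f : 'End(V)) (U H : {vspace V}) :
  (n <= (\dim H).+1)%N -> (\dim U <= (\dim (U :&: (f @^-1: H))).+1)%N.
Proof.
move=> codimH; rewrite -(limg_ker_dim f U).
rewrite -(limg_ker_dim f (U :&: (f @^-1: H))) -capvA.
have -> : ((f @^-1: H) :&: lker f = lker f)%VS.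
  by apply/capv_idPr; rewrite -lpreim0 lpreimS ?sub0v.
have /dimvS : ((f @: U) :&: H <= f @: (U :&: (f @^-1: H)))%VS.
  apply/subvP=> _ /memv_capP[/memv_imgP[u uU ->] fuH].
  by apply: memv_img; rewrite memv_cap uU -memv_preim.
have := dimv_sum_cap (f @: U) H; have := dimvS (subvf (f @: U + H)%VS); lia.
Qed.

(** In terms of [K[t]/(t^n)], a linear form that does not vanish on the socle
    of [K[t]/(t^(d+1))] makes [(a, b) |-> form (a b)] a nondegenerate pairing;
    a nonzero vector orthogonal to [1, t, ..., t^(d-1)] pairs nontrivially with
    [t^d], hence is a unit.  Here [H] is the kernel of that form: the [d]
    conditions leave a space too large to lie in [im phi^(d+1)], and a solution
    outside [im phi^(d+1)] but in [im phi] would be sent by some [phi^i] to a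
    socle element of [H]. *)
Lemma exists_cyclic_vector_in_hyperplane d (H : {vspace V}) :
  regular_nilpotent -> (d < n)%N -> (n <= (\dim H).+1)%N ->
  (im_pow d.+1 <= H)%VS -> ~~ (im_pow d <= H)%VS ->
  exists2 u, u \notin im_pow 1 & forall i, (i < d)%N -> lfun_pow phi i u \in H.
Proof.
move=> reg lt_dn codimH subH nsubH.
have capH : (H :&: im_pow d)%VS = im_pow d.+1.
  apply/esym/eqP; rewrite eqEdim subv_cap subH im_pow_decr //= reg //.
  rewrite -ltnS; have -> : (n - d.+1).+1 = (n - d)%N by lia.
  rewrite -(reg d (ltnW lt_dn)) (ltn_leqif (dimv_leqif_sup (capvSr _ _))).
  by rewrite subv_cap subvv andbT.
(* Impose the [d] conditions one at a time. *)
have [X dimX memX] : exists2 X : {vspace V}, (n - d <= \dim X)%N &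
    forall u i, u \in X -> (i < d)%N -> lfun_pow phi i u \in H.
  elim: (d) => [|e [X dimX memX]]; first by exists fullv; rewrite ?subn0.
  exists (X :&: (lfun_pow phi e @^-1: H))%VS => [|u i].
    have := dim_cap_lpreim (lfun_pow phi e) X codimH; lia.
  rewrite memv_cap -memv_preim ltnS leq_eqVlt => /andP[uX eH].
  by case/orP=> [/eqP-> // | lt_ie]; apply: memX.
have /subvPn[u uX u_notin] : ~~ (X <= im_pow d.+1)%VS.
  by apply/negP=> /dimvS; rewrite reg //; lia.
exists u => [|i lt_id]; last exact: memX.
apply/negP=> u_in1.
(* Let [I_(j+1)] be the last image containing [u]; shift [u] into [I_d]. *)
have exj : exists j, u \notin im_pow j by exists d.+1.
case: (ex_minnP exj) => -[|[|j]]; first by rewrite im_pow0 memvf.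
  by rewrite u_in1.
move=> u_notin_j minj.
have le_jd : (j.+1 <= d)%N by have := minj _ u_notin; lia.
have uj : u \in im_pow j.+1.
  by apply/negPn/negP=> /minj; rewrite ltnn.
have in_d : lfun_pow phi (d - j.+1) u \in im_pow d.
  by have := @regular_mem_im_pow (d - j.+1) j.+1 u reg; rewrite subnK // => ->; lia.
have in_H : lfun_pow phi (d - j.+1) u \in H by apply: memX => //; lia.
have : lfun_pow phi (d - j.+1) u \in im_pow d.+1 by rewrite -capH memv_cap in_H.
have -> : d.+1 = (d - j.+1 + j.+2)%N by lia.
by rewrite regular_mem_im_pow // ?(negPf u_notin_j) //; lia.
Qed.
End ImageFiltration.

(** * Spans of consecutive vectors *)

Section Families.
Variables (K : fieldType) (V : vectType K).
Implicit Types (w : nat -> V) (U : {vspace V}).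
Local Notation n := (\dim (fullv : {vspace V})).

Lemma size_vfamily w i j : size (vfamily w i j) = (j.+1 - i)%N.
Proof. by rewrite size_map size_iota. Qed.

Lemma span_fam_nil w i j : (j < i)%N -> span_fam w i j = 0%VS.
Proof.
move=> lt_ji; rewrite /span_fam /vfamily /index_iota.
by rewrite (_ : j.+1 - i = 0)%N ?span_nil //; lia.
Qed.

Lemma span_fam_cons w i j :
  (i <= j)%N -> span_fam w i j = (<[w i]> + span_fam w i.+1 j)%VS.
Proof.
move=> le_ij; rewrite /span_fam /vfamily /index_iota.
by rewrite subSn // -span_cons subSS.
Qed.

Lemma vfamily_cat w d m : (d <= m)%N ->
  vfamily w 1 m = vfamily w 1 d ++ vfamily w d.+1 m.
Proof.
move=> le_dm; rewrite /vfamily -map_cat; congr map.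
by rewrite /index_iota !subSS !subn0 -[in LHS](subnKC le_dm) iotaD.
Qed.

Lemma span_fam_subv w i j U :
  (forall x, (i <= x <= j)%N -> w x \in U) -> (span_fam w i j <= U)%VS.
Proof.
move=> memU; apply/span_subvP => v /mapP[x x_in ->].
by apply: memU; rewrite mem_index_iota in x_in.
Qed.

Lemma mem_span_fam w i j x : (i <= x <= j)%N -> w x \in span_fam w i j.
Proof.
by move=> x_in; apply/memv_span/mapP; exists x; rewrite // mem_index_iota.
Qed.

Lemma span_fam_sub w i i' j : (i <= i')%N ->
  (span_fam w i' j <= span_fam w i j)%VS.
Proof. by move=> ?; apply: span_fam_subv => x ?; apply: mem_span_fam; lia. Qed.

Lemma span_fam_initial w U :
  basis_of fullv (vfamily w 1 n) -> (\dim U <= n)%N ->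
  (forall x, (1 <= x <= \dim U)%N -> w x \in U) -> U = span_fam w 1 (\dim U).
Proof.
move=> /basis_free free_w le_dn memU; apply/esym/eqP.
rewrite eqEdim (span_fam_subv memU) /=.
move: free_w; rewrite (vfamily_cat _ le_dn) => /catl_free /eqP ->.
by rewrite size_vfamily subn1.
Qed.

Lemma span_fam_disjoint w d :
  basis_of fullv (vfamily w 1 n) -> (d <= n)%N ->
  (span_fam w 1 d :&: span_fam w d.+1 n = 0)%VS.
Proof.
move=> /basis_free free_w le_dn; move: free_w.
by rewrite (vfamily_cat _ le_dn) cat_free => /and3P[_ _ /directv_addP].
Qed.

Lemma dim_span_fam_final w d :
  basis_of fullv (vfamily w 1 n) -> (d <= n)%N ->
  \dim (span_fam w d.+1 n) = (n - d)%N.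
Proof.
move=> /basis_free free_w le_dn; move: free_w.
rewrite (vfamily_cat _ le_dn) => /catr_free /eqP ->.
by rewrite size_vfamily subSS.
Qed.

Variable phi : 'End(V).

(** Each step of the filtration by images has codimension one, so picking one
    vector in each difference [im phi^(x-1) \ im phi^x] yields a basis adapted
    to the filtration. *)
Lemma span_fam_im_pow w :
  regular_nilpotent phi ->
  (forall x, (1 <= x <= n)%N ->
     w x \in im_pow phi x.-1 /\ w x \notin im_pow phi x) ->
  forall j, (j <= n)%N -> span_fam w j.+1 n = im_pow phi j.
Proof.
move=> reg w_in j le_jn; rewrite -(subKn le_jn).
(* Induct downwards, from the zero space [im phi^n]. *)
elim: (n - j)%N (leq_subr j n) => [|i IHi] lt_in.
  by rewrite subn0 regular_im_pow_dim // span_fam_nil.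
rewrite span_fam_cons; last by lia.
have eq_i : (n - i.+1).+1 = (n - i)%N by lia.
rewrite eq_i IHi ?(ltnW lt_in) //.
have [|w_mem w_nmem] := w_in (n - i)%N; first by lia.
have pred_i : (n - i).-1 = (n - i.+1)%N by lia.
rewrite pred_i in w_mem.
apply/eqP; rewrite eqEdim subv_add -memvE w_mem im_pow_decr /=; last by lia.
have /ltn_leqif := dimv_leqif_sup (addvSr <[w (n - i)%N]> (im_pow phi (n - i))).
rewrite subv_add subvv andbT -memvE w_nmem !reg; lia.
Qed.

Lemma basis_im_pow w :
  regular_nilpotent phi ->
  (forall x, (1 <= x <= n)%N ->
     w x \in im_pow phi x.-1 /\ w x \notin im_pow phi x) ->
  basis_of fullv (vfamily w 1 n).
Proof.
move=> reg w_in; rewrite basisEdim size_vfamily subn1 leqnn andbT.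
by rewrite -/(span_fam w 1 n) span_fam_im_pow // im_pow0.
Qed.

(** [phi] acts on [w] as a nilpotent Jordan block up to later vectors, so it
    maps each final span onto the next one, and the images of its powers are
    these final spans. *)
Lemma im_pow_of_shift w :
  basis_of fullv (vfamily w 1 n) ->
  (forall x, (1 <= x < n)%N -> phi (w x) - w x.+1 \in span_fam w x.+2 n) ->
  phi (w n) = 0 ->
  forall j, (j <= n)%N -> im_pow phi j = span_fam w j.+1 n.
Proof.
move=> basis_w shift phi_n.
have img i : (i < n)%N -> (phi @: span_fam w i.+1 n = span_fam w i.+2 n)%VS.
  (* Downwards from [i = n - 1], where [phi (w n) = 0] starts the induction. *)
  move=> lt_in; have -> : i = (n - (n - i.+1).+1)%N by lia.
  have : ((n - i.+1) < n)%N by lia.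
  elim: (n - i.+1)%N => [|k IHk] lt_kn.
    rewrite (_ : (n - 1).+1 = n); last by lia.
    by rewrite span_fam_cons // span_fam_nil // addv0 limg_line phi_n.
  set m := (n - k.+2)%N; have m1 : (n - k.+1)%N = m.+1 by rewrite /m; lia.
  have lt_m : (m.+1 < n)%N by rewrite /m; lia.
  have {}IHk := IHk (ltnW lt_kn); rewrite m1 in IHk.
  rewrite span_fam_cons; last by lia.
  rewrite limgD IHk limg_line [RHS]span_fam_cons //.
  set W := span_fam w m.+3 n.
  have sh : phi (w m.+1) - w m.+2 \in W by apply: shift; lia.
  apply/eqP; rewrite eqEsubv !subv_add -!memvE !addvSr !andbT; apply/andP; split.
    rewrite -(subrK (w m.+2) (phi _)) addrC memv_add ?memv_line //.
  rewrite -(subrK (phi (w m.+1)) (w m.+2)) addrC memv_add ?memv_line //.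
  by rewrite -memvN opprB.
elim=> [|j IHj] lt_jn.
  by rewrite im_pow0; apply/esym/span_basis.
by rewrite -im_powS IHj ?(ltnW lt_jn) // img.
Qed.

End Families.

(** * Partial sums and blocks *)

Lemma partial_sum0 b : partial_sum b 0 = 0%N.
Proof. by rewrite /partial_sum big_geq. Qed.

Lemma partial_sumS b k : partial_sum b k.+1 = (partial_sum b k + b k.+1)%N.
Proof. by rewrite /partial_sum big_nat_recr. Qed.

Lemma partial_sum_mono b i j :
  (i <= j)%N -> (partial_sum b i <= partial_sum b j)%N.
Proof.
move/subnKC <-; elim: (j - i)%N => [|k IHk]; first by rewrite addn0.
by rewrite addnS partial_sumS (leq_trans IHk) ?leq_addr.
Qed.

Section Blocks.
Variables (b : nat -> nat) (p : nat).
Local Notation d := (partial_sum b).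

(** The index [k] with [d_(k-1) < x <= d_k]. *)
Definition block x := find (fun k => x <= d k)%N (iota 0 p.+1).

Lemma blockP x : (0 < x <= d p)%N ->
  (0 < block x <= p)%N && (d (block x).-1 < x <= d (block x))%N.
Proof.
move=> /andP[x_gt0 le_x].
have hasx : has (fun k => x <= d k)%N (iota 0 p.+1).
  by apply/hasP; exists p; rewrite // mem_iota leq0n /= add0n.
have lt_bl : (block x < p.+1)%N by rewrite -[p.+1](size_iota 0) -has_find.
have := nth_find 0%N hasx; rewrite -/(block x) nth_iota // add0n => le_bl.
have bl_gt0 : (0 < block x)%N.
  by case: (block x) le_bl => //; rewrite partial_sum0; lia.
rewrite bl_gt0 -ltnS lt_bl le_bl andbT /= ltnNge.
have lt_pred : ((block x).-1 < block x)%N by rewrite prednK.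
have := before_find 0%N lt_pred.
by rewrite nth_iota ?add0n => [->|]; last exact: ltn_trans lt_pred lt_bl.
Qed.

Lemma block_le x k : (0 < x)%N -> (k <= p)%N -> (x <= d k)%N -> (block x <= k)%N.
Proof.
move=> x_gt0 le_kp le_xk; have le_xp := leq_trans le_xk (partial_sum_mono b le_kp).
have /blockP/andP[_ /andP[lt_x _]] : (0 < x <= d p)%N by rewrite x_gt0.
rewrite leqNgt; apply/negP=> lt_k.
have : (k <= (block x).-1)%N by lia.
by move/(partial_sum_mono b); lia.
Qed.

Lemma block_eq x k : (0 < k <= p)%N -> (d k.-1 < x <= d k)%N -> block x = k.
Proof.
move=> /andP[k_gt0 le_kp] /andP[lt_x le_x].
have x_gt0 : (0 < x)%N by lia.
have le_bk := block_le x_gt0 le_kp le_x.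
have /blockP/andP[_ /andP[_ le_xb]] : (0 < x <= d p)%N.
  by rewrite x_gt0 (leq_trans le_x) ?partial_sum_mono.
apply/eqP; rewrite eqn_leq le_bk leqNgt; apply/negP=> lt_b.
have : (block x <= k.-1)%N by lia.
by move/(partial_sum_mono b); lia.
Qed.

End Blocks.

(** * A basis adapted to the flag and to the images *)

Section AdaptedBasis.
Variables (K : fieldType) (V : vectType K) (phi : 'End(V)).
Local Notation n := (\dim (fullv : {vspace V})).
Local Notation im_pow := (im_pow phi).

(** The component of [v] along [I] is as small as any decomposition of [v] in
    [U + I] makes it, since that decomposition is unique.  The case [J < I]
    yields the sharper congruence in the first block. *)
Lemma sub_daddv_pi (U I J : {vspace V}) v :
  (U :&: I = 0)%VS -> (J <= I)%VS -> (v \in U + J)%VS ->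
  v - daddv_pi U I v \in J.
Proof.
move=> capUI subJI /memv_addP[x xU [y yJ ->]].
have yI := subvP subJI _ yJ.
have piy : daddv_pi U I y = 0.
  have := daddv_pi_add capUI (subvP (addvSr U I) _ yI).
  by rewrite (daddv_pi_id _ yI) 1?capvC // => /(canRL (addrK _)); rewrite subrr.
by rewrite linearD /= piy addr0 daddv_pi_id // addrC addKr.
Qed.

(** The orbit [u, phi u, phi^2 u, ...], indexed from 1 and corrected at each
    step by the projection [pi x]. *)
Fixpoint projected_orbit (pi : nat -> 'End(V)) (u : V) (x : nat) : V :=
  if x is y.+1 then
    pi x (if y is _.+1 then phi (projected_orbit pi u y) else u)
  else u.

Variables (p : nat) (b : nat -> nat) (F : nat -> {vspace V}).
Local Notation d := (partial_sum b).

Lemma flag_mono i j : is_flag_of_dims p d F -> (i <= j <= p)%N -> (F i <= F j)%VS.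
Proof.
case=> _ _ stepF _ /andP[/subnKC <-].
elim: (j - i)%N => [|k IHk]; first by rewrite addn0.
by rewrite addnS => lt_p; apply: subv_trans (IHk (ltnW lt_p)) (stepF _ lt_p).
Qed.

(** The vectors [w x] form the orbit of [u] corrected by projections onto the
    flag; [u] is chosen so that in the first block the uncorrected orbit is
    already in [F_1] modulo [im phi^(d_1+1)]. *)
Lemma transversal_flag_basis :
  (1 < p)%N -> (forall k, (1 <= k <= p)%N -> (1 <= b k)%N) -> d p = n ->
  is_flag_of_dims p d F -> regular_nilpotent phi ->
  (forall k, (k <= p)%N -> (F k :&: im_pow (d k) = 0)%VS) ->
  exists w : nat -> V,
    [/\ forall x, (1 <= x <= n)%N -> w x \in im_pow x.-1 /\ w x \notin im_pow x,
        forall k x, (k <= p)%N -> (1 <= x <= d k)%N -> w x \in F k,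
        forall x, (1 <= x < d 1)%N -> phi (w x) - w x.+1 \in im_pow (d 1).+1
      & forall k x, (2 <= k <= p)%N -> (d k.-1 <= x < d k)%N ->
          phi (w x) - w x.+1 \in im_pow (d k)].
Proof.
move=> p_gt1 b_gt0 dp flagF reg trF; have [_ _ _ dimF] := flagF.
have le_dn k : (k <= p)%N -> (d k <= n)%N.
  by rewrite -dp; apply: partial_sum_mono.
have d1_gt0 : (0 < d 1)%N.
  by rewrite partial_sumS partial_sum0 b_gt0 //= ltnW.
have lt_d1 : (d 1 < n)%N.
  have := le_dn 2%N p_gt1; rewrite (partial_sumS b 1).
  have := b_gt0 2%N p_gt1; lia.
have fullF k : (k <= p)%N -> (F k + im_pow (d k) = fullv)%VS.
  by move=> le_kp; apply: addv_complement; rewrite ?le_dn ?dimF ?trF.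
have p1 := ltnW p_gt1.
pose H := (F 1%N + im_pow (d 1).+1)%VS.
have dimH : (\dim H).+1 = n.
  have capH : (F 1%N :&: im_pow (d 1).+1 = 0)%VS.
    apply/eqP; rewrite -subv0 -(trF 1%N p1) capvS //.
    exact: im_pow_decr.
  by rewrite /H dimv_disjoint_sum // dimF // reg //; lia.
have [|||||u u1 uH] := @exists_cyclic_vector_in_hyperplane _ _ phi (d 1) H => //.
- by rewrite dimH.
- exact: addvSr.
- apply/negP=> sub_H; suff : (fullv <= H)%VS by move/dimvS; lia.
  by rewrite -(fullF 1%N p1) subv_add addvSl.
pose pi x := daddv_pi (F (block b p x)) (im_pow (d (block b p x))).
pose w := projected_orbit pi u.
have w1 : w 1%N = pi 1%N u by [].
have wS x : (0 < x)%N -> w x.+1 = pi x.+1 (phi (w x)) by case: x.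
have block1 x : (1 <= x <= d 1)%N -> block b p x = 1%N.
  by move=> x_in; apply: block_eq; rewrite //= partial_sum0.
have sub_pi x v : (1 <= x <= n)%N -> v - pi x v \in im_pow (d (block b p x)).
  rewrite -dp => /blockP/andP[/andP[_ le_p] _].
  by apply: sub_daddv_pi; rewrite ?trF ?fullF ?memvf.
have step x : (1 <= x < n)%N ->
    phi (w x) - w x.+1 \in im_pow (d (block b p x.+1)).
  by move=> /andP[x_gt0 lt_xn]; rewrite wS // sub_pi.
have le_block x : (1 <= x <= n)%N -> (x <= d (block b p x))%N.
  by rewrite -dp => /blockP/andP[_ /andP[]].
have congr_mem (U : {vspace V}) v v' : v - v' \in U -> (v \in U) = (v' \in U).
  by move=> vv'; rewrite -[in LHS](subrK v' v) rpredDl.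
exists w; split.
- case=> // x; elim: x => [|x IHx] lt_xn.
    rewrite im_pow0 memvf w1; split=> //; rewrite -(congr_mem _ u) //.
    apply: (subvP (im_pow_decr phi d1_gt0)).
    by have := sub_pi 1%N u lt_xn; rewrite block1.
  have [w_in w_nin] := IHx (ltnW lt_xn).
  have sub y : (y <= x.+2)%N -> phi (w x.+1) - w x.+2 \in im_pow y.
    move=> le_y; have le_e := leq_trans le_y (le_block x.+2 lt_xn).
    exact: (subvP (im_pow_decr phi le_e)) (step x.+1 lt_xn).
  rewrite -!(congr_mem _ _ _ (sub _ _)) // !regular_mem_im_powS //.
  by rewrite ltnW.
- move=> k x le_kp /andP[x_gt0 le_x].
  have le_bk := block_le x_gt0 le_kp le_x.
  apply: (subvP (flag_mono flagF (introT andP (conj le_bk le_kp)))).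
  case: x x_gt0 {le_x le_bk} => // -[|x] _; exact: memv_pi.
(* In the first block [w x.+1] stays congruent to [phi^x u] modulo
   [I_(d_1+1)]; hence [phi (w x.+1)] stays in [H], and projecting it changes it
   only by an element of [I_(d_1+1)]. *)
- have corr v x : (1 <= x <= d 1)%N -> v \in H -> v - pi x v \in im_pow (d 1).+1.
    move=> x_in; rewrite /pi block1 //.
    by apply: sub_daddv_pi; rewrite ?trF ?im_pow_decr.
  have next x : (x.+1 < d 1)%N ->
      lfun_pow phi x u - w x.+1 \in im_pow (d 1).+1 ->
      lfun_pow phi x.+1 u - phi (w x.+1) \in im_pow (d 1).+1 /\
      phi (w x.+1) - w x.+2 \in im_pow (d 1).+1.
    move=> lt_x mem_x.
    have shifted : lfun_pow phi x.+1 u - phi (w x.+1) \in im_pow (d 1).+1.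
      rewrite /= comp_lfunE -linearB /=.
      apply: (subvP (im_pow_decr phi (leqnSn _))).
      by rewrite -im_powS memv_img.
    split=> //; rewrite (wS x.+1) //; apply: corr; first by lia.
    by rewrite -(congr_mem _ _ _ (subvP (addvSr _ _) _ shifted)) uH.
  have orbit x : (x < d 1)%N -> lfun_pow phi x u - w x.+1 \in im_pow (d 1).+1.
    elim: x => [|x IHx] lt_x.
      rewrite /= id_lfunE w1 corr //.
      by have := uH 0%N d1_gt0; rewrite /= id_lfunE.
    have [mem1 mem2] := next x lt_x (IHx (ltnW lt_x)).
    by rewrite -(subrKA (phi (w x.+1))) memvD.
  by case=> // x /andP[_ lt_x]; case: (next x lt_x (orbit x (ltnW lt_x))).
move=> k x /andP[k_gt1 le_kp] /andP[le_x lt_x].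
have x_gt0 : (0 < x)%N.
  have := partial_sum_mono b (_ : 1 <= k.-1)%N; lia.
have := le_dn k le_kp; have := step x.
rewrite (@block_eq b p x.+1 k); first by move=> sx ?; apply: sx; lia.
  by lia.
by lia.
Qed.
End AdaptedBasis.

(** * The equivalence *)

Section Equivalence.
Variables (K : fieldType) (V : vectType K) (phi : 'End(V)).
Variables (p : nat) (b : nat -> nat) (F : nat -> {vspace V}).
Local Notation n := (\dim (fullv : {vspace V})).
Local Notation d := (partial_sum b).

Hypothesis b_gt0 : forall k, (1 <= k <= p)%N -> (1 <= b k)%N.
Hypothesis dp : d p = n.
Hypothesis flagF : is_flag_of_dims p d F.

(** Condition (b).  For a flag with a single block it is empty. *)
Definition shift_condition (w : nat -> V) :=
  forall k, (2 <= k <= p)%N -> forall x, (1 <= x <= n)%N ->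
    [/\ (x < d 1)%N -> phi (w x) - w x.+1 \in span_fam w (d 1 + 2)%N n,
        (d k.-1 <= x < d k)%N ->
          phi (w x) - w x.+1 \in span_fam w (d k + 1)%N n
      & x = n -> phi (w x) = 0].

Let le_dn k : (k <= p)%N -> (d k <= n)%N.
Proof. by rewrite -dp; apply: partial_sum_mono. Qed.

Let lt_dn k : (k < p)%N -> (d k < n)%N.
Proof.
move=> lt_kp; have := le_dn lt_kp; rewrite partial_sumS.
have := @b_gt0 k.+1 lt_kp; lia.
Qed.

Lemma flag_basis_of_transversal :
  (1 < p)%N -> regular_nilpotent phi ->
  (forall k, (k <= p)%N -> (F k :&: im_pow phi (d k) = 0)%VS) ->
  exists w : nat -> V,
    [/\ basis_of fullv (vfamily w 1 n),
        forall k, (1 <= k <= p)%N -> F k = span_fam w 1 (d k)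
      & shift_condition w].
Proof.
move=> p_gt1 reg trF; have [_ _ _ dimF] := flagF.
have [w [w_in w_F first_block later]] :=
  transversal_flag_basis p_gt1 b_gt0 dp flagF reg trF.
have basis_w := basis_im_pow reg w_in.
have span_w := span_fam_im_pow reg w_in.
exists w; split=> // [k /andP[_ le_kp] | k /andP[k_gt1 le_kp] x x_in].
  rewrite -(dimF k le_kp); apply: span_fam_initial; rewrite ?dimF ?le_dn //.
  by move=> x; apply: w_F.
split=> [lt_x | x_in_k | eq_x].
- rewrite addn2 span_w ?lt_dn //; apply: first_block; lia.
- by rewrite addn1 span_w ?le_dn //; apply: later; rewrite ?k_gt1.
apply/eqP; rewrite -memv0 -(regular_im_pow_dim reg).
have [wn _] := w_in x x_in; rewrite eq_x in wn *.
have n_gt0 : (0 < n)%N by lia.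
have := @regular_mem_im_powS _ _ phi n.-1 (w n) reg.
by rewrite prednK // wn => ->.
Qed.

(** By [im_pow_of_shift] the images are the final spans of the basis, and a
    final span meets the complementary initial span trivially. *)
Lemma flag_basis_injective w :
  (1 < p)%N -> basis_of fullv (vfamily w 1 n) ->
  (forall k, (1 <= k <= p)%N -> F k = span_fam w 1 (d k)) ->
  shift_condition w ->
  forall k, (k <= p)%N -> \dim (lfun_pow phi (n - d k) @: F k) = d k.
Proof.
move=> p_gt1 basis_w F_w shift_w k le_kp; have [F0 _ _ dimF] := flagF.
have n_gt0 : (0 < n)%N by apply: leq_ltn_trans (lt_dn p_gt1).
have phi_n : phi (w n) = 0.
  have n_in : (1 <= n <= n)%N by rewrite n_gt0 leqnn.
  by have [_ _ ->] := shift_w 2%N p_gt1 n n_in.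
have shift x : (1 <= x < n)%N -> phi (w x) - w x.+1 \in span_fam w x.+2 n.
  move=> /andP[x_gt0 lt_xn].
  have x_in : (1 <= x <= n)%N by rewrite x_gt0 ltnW.
  have [lt_x1 | le_1x] := ltnP x (d 1).
    have [+ _ _] := shift_w 2%N p_gt1 x x_in.
    by move=> /(_ lt_x1); apply/subvP/span_fam_sub; lia.
  have x1_in : (0 < x.+1 <= d p)%N by rewrite dp.
  have /andP[/andP[bl_gt0 le_bl] /andP[lt_x le_x]] := blockP x1_in.
  have bl_gt1 : (1 < block b p x.+1)%N.
    rewrite ltnNge; apply/negP=> bl_le1.
    by move: le_x; rewrite (_ : block b p x.+1 = 1)%N; lia.
  have bl_in : (2 <= block b p x.+1 <= p)%N by rewrite bl_gt1.
  have [_ + _] := shift_w _ bl_in x x_in.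
  move=> sh; apply: (subvP (span_fam_sub _ _ _)) (sh _); lia.
have im_w := im_pow_of_shift basis_w shift phi_n.
have reg : regular_nilpotent phi.
  by move=> j le_jn; rewrite im_w // dim_span_fam_final.
apply/(dim_limg_complement reg (le_dn le_kp) (dimF k le_kp)).
case: k le_kp => [|k] le_kp; first by rewrite F0 cap0v.
by rewrite F_w // im_w ?le_dn // span_fam_disjoint ?le_dn.
Qed.

Lemma flag_criterion :
  (0 < p)%N -> nilpotent_lfun phi ->
  (forall k, (k <= p)%N -> \dim (lfun_pow phi (n - d k) @: F k) = d k) <->
  (exists w : nat -> V,
    [/\ basis_of fullv (vfamily w 1 n),
        forall k, (1 <= k <= p)%N -> F k = span_fam w 1 (d k)
      & shift_condition w]).
Proof.
move=> p_gt0 nil_phi; have [F0 Fp _ dimF] := flagF.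
have [p_gt1 | p_le1] := ltnP 1 p; last first.
  have p1 : p = 1%N by lia.
  split=> _; last first.
    case=> [|k] le_kp; first by rewrite F0 limg0 dimv0 partial_sum0.
    have -> : k.+1 = p by lia.
    by rewrite dp subnn /= lim1g Fp.
  pose w x := (vbasis (fullv : {vspace V}))`_x.-1.
  have basis_w : basis_of fullv (vfamily w 1 n).
    suff -> : vfamily w 1 n = vbasis fullv by apply: vbasisP.
    apply: (@eq_from_nth _ 0); rewrite size_vfamily subn1 /= ?size_tuple //.
    move=> i lt_in; rewrite (nth_map 0%N) ?size_iota ?subn1 //.
    by rewrite nth_iota // subn1.
  exists w; split=> // k k_in; last by lia.
  have -> : k = p by lia.
  by rewrite Fp dp; apply/esym/span_basis.
split=> [inj | [w [basis_w F_w shift_w]]]; last first.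
  exact: (flag_basis_injective p_gt1 basis_w F_w shift_w).
have le1p : (1 <= p)%N := ltnW p_gt1.
have reg : regular_nilpotent phi.
  have lt1 := lt_dn p_gt1; have d1_gt0 : (0 < d 1)%N.
    by rewrite partial_sumS partial_sum0 b_gt0.
  apply: (@regular_nilpotent_of_rank _ _ _ (n - d 1)) => //; first by lia.
  rewrite subKn ?le_dn // -[X in (X <= _)%N](inj 1%N le1p).
  exact: dimvS (limgS _ (subvf _)).
apply: flag_basis_of_transversal => // k le_kp.
exact/(dim_limg_complement reg (le_dn le_kp) (dimF k le_kp)).1/inj.
Qed.

End Equivalence.

Theorem lemma4p2 (R : realType) (V : vectType (complex R)) (n p : nat)
    (b : nat -> nat) (F : nat -> {vspace V}) (phi : 'End(V)) :
  let d := partial_sum b in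
  \dim (fullv : {vspace V}) = n ->
  (1 <= p)%N ->
  (forall k, (1 <= k <= p)%N -> (1 <= b k)%N) ->
  d p = n ->
  is_flag_of_dims p d F ->
  nilpotent_lfun phi ->
  (forall k, (k <= p)%N -> \dim (lfun_pow phi (n - d k)%N @: F k)%VS = d k)
  <->
  (exists w : nat -> V,
    [/\ basis_of fullv (vfamily w 1 n),
        forall k, (1 <= k <= p)%N -> F k = span_fam w 1 (d k)
      & forall k, (2 <= k <= p)%N -> forall x, (1 <= x <= n)%N ->
          [/\ (x < d 1)%N ->
                phi (w x) - w x.+1 \in span_fam w (d 1 + 2)%N n,
              (d k.-1 <= x < d k)%N ->
                phi (w x) - w x.+1 \in span_fam w (d k + 1)%N n
            & x = n -> phi (w x) = 0]]).
Proof.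
move=> d dimV p_gt0 b_gt0 dp flagF nil_phi; subst n.
exact: flag_criterion.
Qed.
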